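(* Let $Q$ be a semimedial left quasigroup. The assignments $\alpha\mapsto\mathrm{Dis}_\alpha$ and $N\mapsto\mathrm{con}_N$ form a monotone Galois connection between $\mathrm{Con}(Q)$ and $\mathrm{Norm}(Q)$ (both ordered by inclusion). That is, $\mathrm{Dis}_\alpha\in\mathrm{Norm}(Q)$ for every $\alpha\in\mathrm{Con}(Q)$, $\mathrm{con}_N\in\mathrm{Con}(Q)$ for every $N\in\mathrm{Norm}(Q)$, both assignments are monotone, and for all $\alpha\in\mathrm{Con}(Q)$ and $N\in\mathrm{Norm}(Q)$, $$\mathrm{Dis}_\alpha\leq N\iff \alpha\leq \mathrm{con}_N.$$
   Context: A left quasigroup is a (nonempty) set $Q$ with binary operations $*,\backslash$ such that $x*(x\backslash y)=y=x\backslash(x*y)$; equivalently every $L_x:y\mapsto x*y$ is a bijection, and $x\backslash y=L_x^{-1}(y)$. It is semimedial if $(x*x)*(y*z)=(x*y)*(x*z)$ for all $x,y,z$. $\mathrm{Con}(Q)$ is the lattice of congruences (equivalence relations compatible with $*$ and $\backslash$). $\mathrm{LMlt}(Q)=\langle L_a: a\in Q\rangle$. For an equivalence relation $\alpha$ on $Q$, $\mathrm{Dis}_\alpha$ is the normal closure in $\mathrm{LMlt}(Q)$ of $\{L_aL_b^{-1}: a\,\alpha\,b\}$. For $N\leq \mathrm{LMlt}(Q)$, $\mathcal{O}_N$ is the orbit equivalence relation of $N$ on $Q$ and $\mathrm{con}_N=\{(a,b)\in Q^2: L_aL_b^{-1}\in N\}$. $\mathrm{Norm}(Q)=\{N\trianglelefteq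 \mathrm{LMlt}(Q): \mathcal{O}_N\leq \mathrm{con}_N\}$. *)

(* Defs.v *)
From HB Require Import structures.
From Corelib Require Export RelationClasses.
From mathcomp Require Export all_boot.
From mathcomp Require Export boolp classical_sets.

Set Implicit Arguments.
Unset Strict Implicit.
Unset Printing Implicit Defensive.

Local Open Scope classical_set_scope.
Local Open Scope group_scope.

(* [ldiv x y] is the left division x \ y. *)
HB.mixin Record Magma_isLeftQuasigroup Q & Magma Q := {
  ldiv : Q -> Q -> Q;
  mul_ldiv : forall x y : Q, x * ldiv x y = y;
  ldiv_mul : forall x y : Q, ldiv x (x * y) = y;
  left_quasigroup_nonempty : inhabited Q
}.

#[short(type="leftQuasigroupType")]
HB.structure Definition LeftQuasigroup :=
  {Q of Magma_isLeftQuasigroup Q & Magma Q}.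

Definition semimedial (Q : leftQuasigroupType) :=
  forall x y z : Q, (x * x) * (y * z) = (x * y) * (x * z).

Definition congruence (Q : leftQuasigroupType) (alpha : Q -> Q -> Prop) :=
  [/\ Equivalence alpha,
      forall a b c d, alpha a b -> alpha c d -> alpha (a * c) (b * d) &
      forall a b c d, alpha a b -> alpha c d -> alpha (ldiv a c) (ldiv b d)].

Section Symmetric.
Variable T : Type.

(* {perm T} requires T to be finite, hence this type for arbitrary T.  The
   inverse is determined by the function, so equality is pointwise equality of
   functions (lemma symP). *)
Record sym := Sym {
  sym_fun :> T -> T;
  sym_inv : T -> T;
  sym_funK : cancel sym_fun sym_inv;
  sym_invK : cancel sym_inv sym_fun
}.

Lemma symP (f g : sym) : f =1 g -> f = g.
Proof.
case: f g => [f f' fK f'K] [g g' gK g'K] /= /funext fg; subst g.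
have eqV : f' = g' by apply/funext=> x; rewrite -{1}[x]g'K fK.
by subst g'; congr Sym; exact: Prop_irrelevance.
Qed.

HB.instance Definition _ := gen_eqMixin sym.
HB.instance Definition _ := gen_choiceMixin sym.

Definition sym_one := @Sym id id (fun=> erefl) (fun=> erefl).

Definition sym_inverse (f : sym) := Sym (sym_invK f) (sym_funK f).

(* (f * g) x = f (g x), whereas products in {perm T} compose left to right. *)
Definition sym_mul (f g : sym) :=
  Sym (can_comp (sym_funK f) (sym_funK g))
      (can_comp (sym_invK g) (sym_invK f)).

Fact sym_mulA : associative sym_mul.
Proof. by move=> f g h; exact: symP. Qed.

Fact sym_mul1 : left_id sym_one sym_mul.
Proof. by move=> f; exact: symP. Qed.

Fact sym_mulr1 : right_id sym_one sym_mul.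
Proof. by move=> f; exact: symP. Qed.

Fact sym_mulV : left_inverse sym_one sym_inverse sym_mul.
Proof. by move=> f; apply: symP => x; exact: sym_funK. Qed.

Fact sym_mulrV : right_inverse sym_one sym_inverse sym_mul.
Proof. by move=> f; apply: symP => x; exact: sym_invK. Qed.

HB.instance Definition _ := isGroup.Build sym
  sym_mulA sym_mul1 sym_mulr1 sym_mulV sym_mulrV.

End Symmetric.

Definition normal_subgroup (G : groupType) (H N : set G) :=
  [/\ group_closed [in N], N `<=` H &
      forall g n, H g -> N n -> N (g * n * g^-1)].

Section Multiplication.
Variable Q : leftQuasigroupType.

Definition Ltrans (x : Q) : sym Q := Sym (@ldiv_mul Q x) (@mul_ldiv Q x).

Definition LMlt : set (sym Q) :=
  smallest [set H | group_closed [in H]] (range Ltrans).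

Definition Dis (alpha : Q -> Q -> Prop) : set (sym Q) :=
  smallest (normal_subgroup LMlt)
    [set f | exists a b, alpha a b /\ f = Ltrans a * (Ltrans b)^-1].

Definition orbit_rel (N : set (sym Q)) (x y : Q) := exists2 f, N f & f x = y.

Definition con (N : set (sym Q)) (a b : Q) := N (Ltrans a * (Ltrans b)^-1).

Definition Norm : set (set (sym Q)) :=
  [set N | normal_subgroup LMlt N /\ subrelation (orbit_rel N) (con N)].

End Multiplication.

(* Main.v *)
Require Import Defs.

(**
  By semimediality [L (x * y) = L (x * x) * L y * (L x)^-1] in [LMlt Q], where
  [L] is [Ltrans].  Hence, modulo [N], the translations by [a * c] and by
  [ldiv a c] are determined by the classes of [L a], [L c] and [L (a * a)], and
  for [con N] to be a congruence it is enough that [con N a b] implies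
  [con N (a * a) (b * b)].  If [con N a b] then [a * a] and [b * a] lie in the
  same [N]-orbit, so [L (a * a)] is congruent to
  [L (b * a) = L (b * b) * L a * (L b)^-1], and thus to [L (b * b)]; this is the
  only use of the hypothesis that orbits of [N] are contained in classes of
  [con N].  For the other direction, the elements of [LMlt Q] that move every
  point inside its [alpha]-class form a normal subgroup, which contains
  [Dis alpha].
*)

Set Implicit Arguments.
Unset Strict Implicit.
Unset Printing Implicit Defensive.

Local Open Scope classical_set_scope.

Section NormalSubgroup.
Local Open Scope group_scope.
Variable G : groupType.
Implicit Types (H N : set G) (f g : G).

Lemma group_closed_setP H :
  group_closed [in H] <-> H 1 /\ forall f g, H f -> H g -> H (f * g^-1).
Proof.
split=> -[H1 HF]; split.
- exact: set_mem.
- by move=> f g Hf Hg; apply/set_mem/HF; exact: mem_set.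
- exact: mem_set.
- by move=> f g /set_mem Hf /set_mem Hg; apply/mem_set/HF.
Qed.

Lemma group_closed_invg H f : group_closed [in H] -> H f -> H f^-1.
Proof. by case/group_closed_setP=> H1 HF Hf; rewrite -div1g; exact: HF. Qed.

Lemma group_closed_mulg H f g : group_closed [in H] -> H f -> H g -> H (f * g).
Proof.
move=> HG Hf Hg; rewrite -[g]invgK.
have [_ HF] := (group_closed_setP H).1 HG; apply: HF => //.
exact: group_closed_invg.
Qed.

Lemma group_closed_smallest (X : set G) :
  group_closed [in smallest [set H | group_closed [in H]] X].
Proof.
apply/group_closed_setP; split=> [H [/group_closed_setP[]] //|f g Xf Xg H HX].
have [_ HF] := (group_closed_setP H).1 HX.1.
by apply: HF; [exact: Xf | exact: Xg].
Qed.

Lemma normal_subgroup_refl H : group_closed [in H] -> normal_subgroup H H.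
Proof.
move=> HG; split=> // f g Hf Hg.
by do !apply: group_closed_mulg => //; exact: group_closed_invg.
Qed.

Lemma normal_subgroup_smallest H (X : set G) :
  group_closed [in H] -> X `<=` H ->
  normal_subgroup H (smallest (normal_subgroup H) X).
Proof.
move=> HG XH; split.
- apply/group_closed_setP.
  split=> [N [[/group_closed_setP[]]] //|f g Xf Xg N NX].
  have [[/group_closed_setP[_ NF] _ _] _] := NX.
  by apply: NF; [exact: Xf | exact: Xg].
- by apply: smallest_sub => //; exact: normal_subgroup_refl.
- by move=> f g Hf Xg N NX; have [[_ _ NJ] _] := NX; apply: NJ => //; exact: Xg.
Qed.

(** Equality of the cosets of [f] and [g] modulo [N]; [con N a b] unfolds to
    [eqmod N (Ltrans a) (Ltrans b)], so the lemmas below apply to [con] as they stand. *)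
Definition eqmod N f g := N (f * g^-1).

Section Congruence.
Variables H N : set G.
Hypothesis nsN : normal_subgroup H N.

Let NG : group_closed [in N]. Proof. by case: nsN. Qed.

Lemma eqmod_refl f : eqmod N f f.
Proof. by rewrite /eqmod mulgV; case/group_closed_setP: NG. Qed.

Lemma eqmod_sym f g : eqmod N f g -> eqmod N g f.
Proof. by move=> /(group_closed_invg NG); rewrite invgM invgK. Qed.

Lemma eqmod_trans f g h : eqmod N f g -> eqmod N g h -> eqmod N f h.
Proof.
move=> Nfg Ngh; have := group_closed_mulg NG Nfg Ngh.
by rewrite mulgA mulgVK.
Qed.

(** The quotient factors as [(f * (f' * g'^-1) * f^-1) * (f * g^-1)], whose first factor is a
    conjugate by [f]. *)
Lemma eqmod_mulg f f' g g' :
  H f -> eqmod N f g -> eqmod N f' g' -> eqmod N (f * f') (g * g').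
Proof.
case: nsN => _ _ NJ Hf Nfg /(NJ _ _ Hf) Nfg'.
have := group_closed_mulg NG Nfg' Nfg.
by rewrite /eqmod invgM !mulgA mulgVK.
Qed.

Lemma eqmod_invg f g :
  group_closed [in H] -> H f -> eqmod N f g -> eqmod N f^-1 g^-1.
Proof.
case: nsN => _ _ NJ HG Hf /eqmod_sym /(NJ _ _ (group_closed_invg HG Hf)).
by rewrite /eqmod !invgK !mulgA mulgVK.
Qed.

End Congruence.
End NormalSubgroup.

Section LeftQuasigroup.
Local Open Scope group_scope.
Variable Q : leftQuasigroupType.
Implicit Types (alpha : Q -> Q -> Prop) (N : set (sym Q)).

Lemma group_closed_LMlt : group_closed [in @LMlt Q].
Proof. exact: group_closed_smallest. Qed.

Lemma LMlt_Ltrans (a : Q) : LMlt (Ltrans a).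
Proof. by apply: sub_gen_smallest; exists a. Qed.

Lemma Dis_sub_normal alpha N : normal_subgroup (@LMlt Q) N ->
  subrelation alpha (con N) -> Dis alpha `<=` N.
Proof.
by move=> nsN aN; apply: smallest_sub => // _ [a [b [ab ->]]]; exact: aN.
Qed.

Lemma subrelation_con_Dis alpha : subrelation alpha (con (Dis alpha)).
Proof. by move=> a b ab; apply: sub_gen_smallest; exists a, b. Qed.

Lemma normal_subgroup_Dis alpha : normal_subgroup (@LMlt Q) (Dis alpha).
Proof.
apply: normal_subgroup_smallest; first exact: group_closed_LMlt.
move=> _ [a [b [_ ->]]].
have [_ HF] := (group_closed_setP _).1 group_closed_LMlt.
by apply: HF; exact: LMlt_Ltrans.
Qed.

(* Preservation is stated with an equivalence because a permutation preserving
   [alpha] in one direction only need not have an inverse preserving it. *)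
Lemma LMlt_congruence alpha f : congruence alpha -> LMlt f ->
  forall x y, alpha (f x) (f y) <-> alpha x y.
Proof.
move=> [eqv cM cD]; have xx := @Equivalence_Reflexive _ _ eqv.
pose H : set (sym Q) := [set f | forall x y, alpha (f x) (f y) <-> alpha x y].
move=> Lf; suff: H f by []; apply: Lf; split=> [|_ [a _ <-] x y].
  apply/group_closed_setP; split=> // g h Hg Hh x y.
  by rewrite Hg -(Hh (h^-1 x) (h^-1 y)) /= !sym_invK.
split=> [axy|xy]; last exact: cM.
by rewrite -(ldiv_mul a x) -(ldiv_mul a y); exact: cD.
Qed.

Lemma orbit_rel_Dis alpha : congruence alpha ->
  subrelation (orbit_rel (Dis alpha)) alpha.
Proof.
move=> ca; have [eqv cM cD] := ca; case: (eqv) => xx sy tr.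
pose N : set (sym Q) := @LMlt Q `&` [set f | forall x, alpha (f x) x].
suff DN : Dis alpha `<=` N by move=> x _ [f /DN[_ fa] <-]; exact: sy.
have [L1 LF] := (group_closed_setP _).1 group_closed_LMlt.
apply: smallest_sub => [|_ [a [b [ab ->]]]]; last first.
  split=> [|x]; first by apply: LF; exact: LMlt_Ltrans.
  (* The generator sends [x] to [a * ldiv b x], while [x = b * ldiv b x]. *)
  by rewrite -[X in alpha _ X](mul_ldiv b x); exact: cM.
split=> [|? []//|g n Lg [Ln na]].
  apply/group_closed_setP; split=> [|f g [Lf fa] [Lg ga]]; first by split.
  split=> [|x]; first exact: LF.
  apply: tr (fa _) _; rewrite -[X in alpha _ X](sym_invK g x); exact: sy.
split=> [|x].
  by apply: LF => //; exact: group_closed_mulg group_closed_LMlt _ _.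
(* With [x = g (g^-1 x)], cancelling [g] leaves that [n] moves [g^-1 x] inside its class. *)
by rewrite -[X in alpha _ X](sym_invK g x); apply/(LMlt_congruence ca Lg).
Qed.

Lemma Norm_Dis alpha : congruence alpha -> Norm (Dis alpha).
Proof.
move=> ca; split=> [|x y /(orbit_rel_Dis ca)]; first exact: normal_subgroup_Dis.
exact: subrelation_con_Dis.
Qed.

Section Semimedial.
Hypothesis semimedialQ : semimedial Q.

(** Semimediality at [x], [y], [ldiv x z], where [x * ldiv x z = z]. *)
Lemma Ltrans_mul (x y : Q) :
  Ltrans (x * y) = Ltrans (x * x) * Ltrans y * (Ltrans x)^-1.
Proof. by apply: symP => z /=; rewrite semimedialQ mul_ldiv. Qed.

(** Apply [Ltrans_mul] to [y = x * ldiv x y] and solve for the middle factor. *)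
Lemma Ltrans_ldiv (x y : Q) :
  Ltrans (ldiv x y) = (Ltrans (x * x))^-1 * Ltrans y * Ltrans x.
Proof.
rewrite -[in RHS](mul_ldiv x y) (Ltrans_mul x (ldiv x y)).
by rewrite -!mulgA mulVg mulg1 mulKg.
Qed.

Lemma con_square N a b : Norm N -> con N a b -> con N (a * a) (b * b).
Proof.
move=> [nsN oN] ab.
have aa_ba : con N (a * a) (b * a).
  (* This element of [N] sends [b * a] to [a * ldiv b (b * a) = a * a]. *)
  apply/(eqmod_sym nsN)/oN; exists (Ltrans a * (Ltrans b)^-1) => //=.
  by rewrite ldiv_mul.
apply: (eqmod_trans nsN aa_ba).
(* Both sides become [Ltrans (b * b) * _ * (Ltrans b)^-1], with middle factors [Ltrans a] and
   [Ltrans b]. *)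
rewrite (Ltrans_mul b a) -[X in eqmod _ _ X](mulgK (Ltrans b)).
have LG := group_closed_LMlt.
apply: (eqmod_mulg nsN); last exact: (eqmod_refl nsN).
  by apply: (group_closed_mulg LG); exact: LMlt_Ltrans.
by apply: (eqmod_mulg nsN (LMlt_Ltrans _)) => //; exact: (eqmod_refl nsN).
Qed.

Lemma congruence_con N : Norm N -> congruence (con N).
Proof.
move=> NN; have [nsN _] := NN; have LG := group_closed_LMlt; split.
- split=> [x|x y|x y z]; [exact: eqmod_refl nsN _| exact: (eqmod_sym nsN)|].
  exact: (eqmod_trans nsN).
- move=> a b c d ab cd; have aabb := con_square NN ab.
  rewrite /con (Ltrans_mul a) (Ltrans_mul b).
  apply: (eqmod_mulg nsN).
  + by apply: (group_closed_mulg LG); exact: LMlt_Ltrans.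
  + by apply: (eqmod_mulg nsN) => //; exact: LMlt_Ltrans.
  + by apply: (eqmod_invg nsN) => //; exact: LMlt_Ltrans.
- move=> a b c d ab cd; rewrite /con !Ltrans_ldiv.
  have La2 := LMlt_Ltrans (a * a); have LaV := group_closed_invg LG La2.
  apply: (eqmod_mulg nsN) => //.
    by apply: (group_closed_mulg LG LaV); exact: LMlt_Ltrans.
  apply: (eqmod_mulg nsN) => //.
  by apply: (eqmod_invg nsN) => //; exact: (con_square NN ab).
Qed.

End Semimedial.
End LeftQuasigroup.

Theorem theorem3p5 (Q : leftQuasigroupType) (semimedialQ : semimedial Q) :
  (forall alpha : Q -> Q -> Prop, congruence alpha -> Norm (Dis alpha)) /\
  (forall N : set (sym Q), Norm N -> congruence (con N)) /\
  (forall alpha beta : Q -> Q -> Prop, congruence alpha -> congruence beta ->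
     subrelation alpha beta -> Dis alpha `<=` Dis beta) /\
  (forall N M : set (sym Q), Norm N -> Norm M ->
     N `<=` M -> subrelation (con N) (con M)) /\
  (forall (alpha : Q -> Q -> Prop) (N : set (sym Q)),
     congruence alpha -> Norm N ->
     (Dis alpha `<=` N <-> subrelation alpha (con N))).
Proof.
split; first by move=> alpha; exact: Norm_Dis.
split; first by move=> N; exact: congruence_con.
split.
  (* [Dis beta] is a normal subgroup containing the generators of [Dis alpha]. *)
  move=> alpha beta _ _ ab; apply: Dis_sub_normal.
    exact: normal_subgroup_Dis.
  by move=> x y /ab; exact: subrelation_con_Dis.
split; first by move=> N M _ _ NM a b; exact: NM.
move=> alpha N _ [nsN _]; split=> [DN x y xy|]; last exact: Dis_sub_normal.
by apply: DN; exact: subrelation_con_Dis.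
Qed.
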